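(* Let $z$ be an integer with $z>2$. The density $\rho$ of the graph $G_t^z$ (a function of $t$) satisfies $\rho\to 0$ as $t\to\infty$.
   Context: Fix an integer $z>2$. The finite simple graphs $G_t^z$ ($t=0,1,2,\dots$), each with a distinguished vertex called its root (its largest, original hub node) and a distinguished set of vertices called its last-layer bottom nodes, are defined recursively. $G_0^z$ is a triangle; one of its vertices is the root (hub node) and the other two are its (last-layer) bottom nodes. For $t\ge1$, $G_t^z$ is formed from the disjoint union of $z$ copies of $G_{t-1}^z$, one called the original and the other $z-1$ called replicas, by adding an edge from the root of the original copy to every last-layer bottom node of each of the $z-1$ replicas. The root of $G_t^z$ is the root of the original copy, and the last-layer bottom nodes of $G_t^z$ are the last-layer bottom nodes of all $z-1$ replicas. The density of a graph with $N$ vertices and $E$ edges is $\rho=\frac{2E}{N(N-1)}$. *)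

(* Defs.v *)
From HB Require Import structures.
From mathcomp Require Import all_boot all_order all_algebra.
From mathcomp Require Import all_classical all_reals all_analysis.
Import Order.TTheory GRing.Theory Num.Theory.

Set Implicit Arguments.
Unset Strict Implicit.
Unset Printing Implicit Defensive.

Record simple_graph := SimpleGraph {
  vertex :> finType;
  adj : rel vertex;
  adj_sym : symmetric adj;
  adj_irr : irreflexive adj
}.

Definition edges (G : simple_graph) : {set {set G}} :=
  [set [set p.1; p.2] | p : G * G & adj p.1 p.2].

Definition density (R : realType) (G : simple_graph) : R :=
  (2 * #|edges G|%:R / (#|G|%:R * (#|G|%:R - 1)))%R.

Record hier_graph := HierGraph {
  hgraph :> simple_graph;
  root : hgraph;
  bottom : {set hgraph}
}.

Lemma neq_sym (T : eqType) : symmetric (fun x y : T => x != y).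
Proof. by move=> x y; rewrite eq_sym. Qed.

Lemma neq_irr (T : eqType) : irreflexive (fun x y : T => x != y).
Proof. by move=> x; rewrite eqxx. Qed.

Definition triangle : simple_graph :=
  @SimpleGraph 'I_3 (fun x y => x != y) (@neq_sym _) (@neq_irr _).

Definition hier0 : hier_graph :=
  @HierGraph triangle (ord0 : 'I_3) [set~ (ord0 : 'I_3)].

Section Step.
Variables (z : nat) (H : hier_graph).

(* [None] labels the original copy and [Some i], i < z - 1, the replicas, so
   there are z copies in total as soon as 0 < z. *)
Definition step_vertex : finType := (option 'I_z.-1 * H)%type.

Definition step_root : step_vertex := (None, root H).

Definition step_bottom : {set step_vertex} :=
  [set u | isSome u.1 & u.2 \in bottom H].

Definition step_adj : rel step_vertex := fun u v =>
  [|| (u.1 == v.1) && adj u.2 v.2,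
      (u == step_root) && (v \in step_bottom)
    | (v == step_root) && (u \in step_bottom)].

Lemma step_adj_sym : symmetric step_adj.
Proof.
by move=> u v; rewrite /step_adj eq_sym adj_sym; congr (_ || _); rewrite orbC.
Qed.

Lemma step_adj_irr : irreflexive step_adj.
Proof.
move=> u; rewrite /step_adj adj_irr andbF orbb /=.
by apply/negP => /andP[/eqP ->]; rewrite inE.
Qed.

Definition hier_step : hier_graph :=
  @HierGraph (SimpleGraph step_adj_sym step_adj_irr) step_root step_bottom.

End Step.

Fixpoint hier (z t : nat) : hier_graph :=
  if t is t'.+1 then hier_step z (hier z t') else hier0.

(* Main.v *)
Require Import Defs.
From HB Require Import structures.
From mathcomp Require Import all_boot all_order all_algebra.
From mathcomp Require Import all_classical all_reals all_analysis.
From mathcomp Require Import zify ring lra.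
Import Order.TTheory GRing.Theory Num.Theory.
Import numFieldNormedType.Exports.

(** With N_t, B_t, E_t the numbers of vertices, bottom nodes and edges,
    N_t = 3 z^t and B_t = 2 (z-1)^t, while E_(t+1) <= z E_t + B_(t+1). Hence
    E_t + (z-1) B_t <= (2z+1) z^t, so E_t = O(N_t) and the density is O(z^-t). *)

Lemma card_hier (z t : nat) : (0 < z)%N -> #|hier z t| = (3 * z ^ t)%N.
Proof.
move=> z0; elim: t => [|t IH]; first by rewrite card_ord.
by rewrite card_prod card_option card_ord prednK // IH expnS mulnCA.
Qed.

Lemma card_step_bottom (z : nat) (H : hier_graph) :
  #|Defs.bottom (hier_step z H)| = (z.-1 * #|Defs.bottom H|)%N.
Proof.
rewrite -[X in (X * _)%N]card_ord -cardsT -cardsX.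
(* [f] embeds each replica; the original copy, labelled [None], contributes no bottom node, so the
   bottom set is an image under [f]. *)
pose f (p : 'I_z.-1 * H) : hier_step z H := (Some p.1, p.2).
have f_inj : injective f by move=> [i x] [j y] [-> ->].
rewrite -(card_imset _ f_inj); apply: eq_card => -[[i|] x].
- by rewrite (mem_imset _ (i, x) f_inj) !inE.
- by rewrite !inE; apply/esym/negP => /imsetP[? _].
Qed.

Lemma card_bottom_hier (z t : nat) :
  #|Defs.bottom (hier z t)| = (2 * z.-1 ^ t)%N.
Proof.
elim: t => [|t IH]; first by rewrite cardsC1 card_ord.
by rewrite card_step_bottom IH expnS mulnCA.
Qed.

(** The first disjunct of [step_adj] gives a translate [pair i @: e] of an old edge, the other two
    the same unordered edge at the root. Inclusion suffices for an upper bound on edges. *)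
Lemma step_edges_subset (z : nat) (H : hier_graph) :
  edges (hier_step z H) \subset
    [set pair p.1 @: p.2 |
       p : option 'I_z.-1 * {set H} in
         finset.setX [set: option 'I_z.-1] (edges H)]
    :|: [set [set Defs.root (hier_step z H); v] | v in Defs.bottom (hier_step z H)].
Proof.
apply/fintype.subsetP => e /imsetP[[[i x] [j y]]]; rewrite inE /= => uv ->.
rewrite inE; case/or3P: uv => /=.
- case/andP => /eqP <- xy; apply/orP; left; apply/imsetP.
  exists (i, [set x; y]); last by rewrite imsetU1 imset_set1.
  by rewrite !inE; apply/imsetP; exists (x, y); rewrite ?inE.
- case/andP => /eqP -> vB; apply/orP; right.
  by apply/imsetP; exists (j, y).
- case/andP => /eqP -> uB; apply/orP; right.
  by apply/imsetP; exists (i, x) => //; rewrite finset.setUC.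
Qed.

Lemma card_step_edges_le (z : nat) (H : hier_graph) : (0 < z)%N ->
  (#|edges (hier_step z H)| <= z * #|edges H| + #|Defs.bottom (hier_step z H)|)%N.
Proof.
move=> z0; apply: leq_trans (subset_leq_card (step_edges_subset z H)) _.
apply: leq_trans (leq_card_setU _ _) _; apply: leq_add; last first.
  exact: leq_imset_card.
apply: leq_trans (leq_imset_card _ _) _.
by rewrite cardsX cardsT card_option card_ord prednK.
Qed.

Lemma card_edges_hier0_le : (#|edges hier0| <= 3)%N.
Proof.
have /subset_leq_card/leq_trans : edges hier0 \subset
    [set e : {set 'I_3} | #|e| == 2%N].
  apply/fintype.subsetP => e /imsetP[[x y]]; rewrite inE /= => xy ->.
  by rewrite inE cards2 xy.
by apply; rewrite card_draws card_ord.
Qed.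

(** The added term is a potential absorbing the new root edges: as B_(t+1) = (z-1) B_t, the bound z
    E_t + B_(t+1) + (z-1) B_(t+1) equals z (E_t + (z-1) B_t). So the sum grows by a factor at most
    z, from at most 3 + 2(z-1) = 2z+1. *)
Lemma card_edges_hier_le (z t : nat) : (0 < z)%N ->
  (#|edges (hier z t)| + z.-1 * #|Defs.bottom (hier z t)| <= z.*2.+1 * z ^ t)%N.
Proof.
move=> z0; elim: t => [|t IH].
  have := card_edges_hier0_le; rewrite card_bottom_hier /=; lia.
have := card_step_edges_le z (hier z t) z0.
rewrite -/(hier z t.+1) card_bottom_hier in IH *; rewrite card_bottom_hier.
by rewrite !expnS; nia.
Qed.

Local Open Scope classical_set_scope.
Local Open Scope ring_scope.

Lemma density_hier_le (R : realType) (z t : nat) : (0 < z)%N ->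
  0 <= density R (hier z t) <= z.*2.+1%:R * z%:R^-1 ^+ t.
Proof.
move=> z0; rewrite /density card_hier // natrM natrX.
have zt1 : 1 <= z%:R ^+ t :> R by rewrite exprn_ege1 // ler1n.
have Ele : #|edges (hier z t)|%:R <= z.*2.+1%:R * z%:R ^+ t :> R.
  rewrite -natrX -natrM ler_nat.
  exact: (leq_trans (leq_addr _ _) (card_edges_hier_le z t z0)).
have E0 : 0 <= #|edges (hier z t)|%:R :> R by [].
have c0 : 0 <= z.*2.+1%:R :> R by [].
(* From here on [N] stands for z^t, so the number of vertices is 3 * N. *)
rewrite exprVn; move: (_ ^+ t) zt1 Ele => N N1 Ele.
have N0 : 0 < N by lra.
have D0 : 0 < 3 * N * (3 * N - 1) by apply: mulr_gt0; lra.
apply/andP; split; first by apply: divr_ge0; lra.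
rewrite ler_pdivrMr //.
have -> : z.*2.+1%:R / N * (3 * N * (3 * N - 1))
          = 3 * z.*2.+1%:R * (3 * N - 1) by field; lra.
(* With c = 2z+1, E <= c N gives 2E <= 2c N, and 2N <= 3 (3N - 1) because N >= 1. *)
nra.
Qed.

Theorem theorem3p2 (R : realType) (z : nat) (hz : (2 < z)%N) :
  density R (hier z t) @[t --> \oo] --> (0 : R).
Proof.
have z0 : (0 < z)%N by apply: leq_trans hz.
apply: (@squeeze_cvgr _ _ _ _ (fun=> 0) (fun t => z.*2.+1%:R * z%:R^-1 ^+ t)).
- by apply: nearW => t; apply: density_hier_le.
- exact: cvg_cst.
(* The limit 0 is written as a constant times 0, the limit of a geometric sequence of ratio 1/z <
   1. *)
- rewrite -[X in _ --> X](mulr0 z.*2.+1%:R).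
  apply: cvgM; first exact: cvg_cst.
  apply: cvg_expr; rewrite ger0_norm ?invr_ge0 // invf_lt1 ?ltr0n //.
  by rewrite ltr1n (leq_trans _ hz).
Qed.
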